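(* If a normal modal logic (over a finite alphabet of modalities) admits the finite height criterion, then it admits the 1-finiteness condition.
   Context: Normal logic over a finite alphabet $\mathrm{Al}$ of unary modalities (contains tautologies, $\neg\Diamond\bot$, $\Diamond(p_0\vee p_1)\to\Diamond p_0\vee\Diamond p_1$, closed under modus ponens, substitution, monotonicity); an extension of $L_0$ is a normal logic over the same alphabet containing $L_0$. For $\mathrm C\subseteq\mathrm{Al}$, $L^{\restriction\mathrm C}$ is the set of formulas over $\mathrm C$ in $L$. $L$ is $k$-finite if it has only finitely many pairwise $L$-nonequivalent formulas in variables $p_0,\dots,p_{k-1}$; locally tabular if $k$-finite for all $k<\omega$. For a logic $L$ over $\mathrm C$: $\Diamond_{\mathrm C}\varphi=\bigvee_{\Diamond\in\mathrm C}\Diamond\varphi$, $\Diamond^{\le m}_{\mathrm C}\varphi=\bigvee_{i\le m}\Diamond^i_{\mathrm C}\varphi$; $\mathrm{tra}(L)$ is the least $m$ with $\Diamond^{m+1}_{\mathrm C}p\to\Diamond^{\le m}_{\mathrm C}p\in L$ ($\omega$ if none). If $\mathrm{tra}(L)=m<\omega$, $\Diamond^*=\Diamond^{\le m}_{\mathrm C}$; $B_0=\bot$, $B_h=p_h\to\Box(\Diamond p_h\vee B_{h-1})$, and $B^*_h$ is $B_h$ with $\Diamond,\Box$ replaced by $\Diamond^*,\neg\Diamond^*\neg$. The height $h(L)$ is the least $h$ with $B^*_h\in L$ ($\omega$ if none or if $L$ is not pretransitive). $L_0$ over $\mathrm{Al}$ admits the finite height criterion if for every extension $L$ of $L_0$: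 $L$ is locally tabular iff $h(L^{\restriction\mathrm C})<\omega$ for all $\mathrm C\subseteq\mathrm{Al}$. $L_0$ admits the 1-finiteness condition if every 1-finite extension of $L_0$ is locally tabular. *)

(* Defs.v *)
From HB Require Import structures.
From mathcomp Require Import all_boot.
From mathcomp Require Import boolp classical_sets cardinality.

Set Implicit Arguments.
Unset Strict Implicit.
Unset Printing Implicit Defensive.

Local Open Scope classical_set_scope.

Section Formulas.
Variable A : Type.

Inductive form : Type :=
| Var of nat
| Bot
| Imp of form & form
| Dia of A & form.

Definition Neg phi := Imp phi Bot.
Definition Or phi psi := Imp (Neg phi) psi.
Definition And phi psi := Neg (Imp phi (Neg psi)).
Definition Iff phi psi := And (Imp phi psi) (Imp psi phi).

Fixpoint subst (s : nat -> form) (phi : form) : form :=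
  match phi with
  | Var n => s n
  | Bot => Bot
  | Imp phi1 phi2 => Imp (subst s phi1) (subst s phi2)
  | Dia a phi1 => Dia a (subst s phi1)
  end.

(* [v] gives the values of the variables and of the formulas of the form
   [Dia a phi], which are treated as atoms. *)
Fixpoint eval (v : form -> bool) (phi : form) : bool :=
  match phi with
  | Bot => false
  | Imp phi1 phi2 => eval v phi1 ==> eval v phi2
  | _ => v phi
  end.

Definition tautology (phi : form) : Prop := forall v, eval v phi.

Fixpoint vars_below (k : nat) (phi : form) : bool :=
  match phi with
  | Var n => n < k
  | Bot => true
  | Imp phi1 phi2 => vars_below k phi1 && vars_below k phi2
  | Dia _ phi1 => vars_below k phi1
  end.

Record normal_logic (L : set form) : Prop := NormalLogic {
  normal_taut : forall phi, tautology phi -> L phi;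
  normal_bot : forall a, L (Neg (Dia a Bot));
  normal_or : forall a,
    L (Imp (Dia a (Or (Var 0) (Var 1)))
           (Or (Dia a (Var 0)) (Dia a (Var 1))));
  normal_mp : forall phi psi, L phi -> L (Imp phi psi) -> L psi;
  normal_subst : forall s phi, L phi -> L (subst s phi);
  normal_mono : forall a phi psi,
    L (Imp phi psi) -> L (Imp (Dia a phi) (Dia a psi))
}.

Definition extension (L0 L : set form) : Prop :=
  normal_logic L /\ L0 `<=` L.

Definition eq_class (L : set form) (k : nat) (phi : form) : set form :=
  [set psi | vars_below k psi /\ L (Iff phi psi)].

Definition k_finite (k : nat) (L : set form) : Prop :=
  finite_set [set eq_class L k phi | phi in [set phi | vars_below k phi]].

Definition locally_tabular (L : set form) : Prop := forall k, k_finite k L.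

End Formulas.

Arguments Var {A} _.
Arguments Bot {A}.

Fixpoint map_form (A B : Type) (f : A -> B) (phi : form A) : form B :=
  match phi with
  | Var n => Var n
  | Bot => Bot
  | Imp phi1 phi2 => Imp (map_form f phi1) (map_form f phi2)
  | Dia a phi1 => Dia (f a) (map_form f phi1)
  end.

(* A logic over [C] is a set of formulas over the alphabet [{a | a \in C}];
   [map_form val] is the inclusion of these formulas among those over [Al]. *)
Definition restrict (Al : finType) (L : set (form Al)) (C : {set Al}) :
  set (form {a : Al | a \in C}) := [set phi | L (map_form val phi)].
Arguments restrict {Al} L C _.

(* Elements of omega + 1: [None] stands for omega. *)
Definition least (P : nat -> Prop) : option nat :=
  match pselect (exists n, `[< P n >]) with
  | left e => Some (ex_minn e)
  | right _ => None
  end.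

Section Height.
Variable A : finType.

Definition DiaAll (phi : form A) : form A :=
  \big[@Or A/Bot]_(a : A) Dia a phi.

Definition DiaLe (m : nat) (phi : form A) : form A :=
  \big[@Or A/Bot]_(i < m.+1) iter i DiaAll phi.

Definition tra (L : set (form A)) : option nat :=
  least (fun m => L (Imp (iter m.+1 DiaAll (Var 0)) (DiaLe m (Var 0)))).

(* [Bform D h] is $B_h$ with $\Diamond$ read as [D] and $\Box$ as its dual. *)
Fixpoint Bform (D : form A -> form A) (h : nat) : form A :=
  match h with
  | 0 => Bot
  | h'.+1 => Imp (Var h) (Neg (D (Neg (Or (D (Var h)) (Bform D h')))))
  end.

Definition height (L : set (form A)) : option nat :=
  if tra L is Some m then least (fun h => L (Bform (DiaLe m) h)) else None.

End Height.

Definition finite_height_criterion (Al : finType) (L0 : set (form Al)) : Prop :=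
  forall L, extension L0 L ->
    (locally_tabular L <-> forall C : {set Al}, isSome (height (restrict L C))).

Definition one_finiteness_condition (Al : finType) (L0 : set (form Al)) : Prop :=
  forall L, extension L0 L -> k_finite 1 L -> locally_tabular L.

(* Main.v *)
Require Import Defs.
From mathcomp Require Import all_boot.
From mathcomp Require Import boolp classical_sets cardinality.

Set Implicit Arguments.
Unset Strict Implicit.
Unset Printing Implicit Defensive.

Local Open Scope classical_set_scope.

(* If [L] is 1-finite, so is each restriction [L|C], hence it suffices that a
   1-finite normal logic has finite height. The formulas [DiaLe m p] cannot be
   pairwise nonequivalent, which gives pretransitivity, so that [D = DiaLe m]
   is an S4 modality. Let [alternation D j p] say that some [D]-chain starting
   in [p] changes the value of [p] at least [j] times. By 1-finiteness
   [alternation k p -> alternation k.+1 p] is in [L] for some [k]. A refutation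
   of [B_k] yields a rank function with values in [0..k] that is nonincreasing
   along [D] and a chain on which all [k.+1] ranks occur; for [p] the parity of
   the rank, this chain has [k] alternations while no chain has more. *)

(** Truth tables: only the values of atoms and of schematic formulas, such as [D x] for abstract
    [D], remain to be split on. *)
Ltac taut := let v := fresh "v" in move=> v /=;
  repeat match goal with
  | |- context [eval v ?x] => case: (eval v x)
  | |- context [v ?x] => case: (v x)
  end; done.

(** * Derived rules and normal operators *)

Section Derivations.
Variables (A : Type) (L : set (form A)).
Hypothesis nL : normal_logic L.
Implicit Types x y z : form A.

Lemma taut_mp x y : L x -> tautology (Imp x y) -> L y.
Proof. by move=> Lx /(normal_taut nL); apply: normal_mp. Qed.

Lemma taut_mp2 x y z : L x -> L y -> tautology (Imp x (Imp y z)) -> L z.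
Proof. by move=> Lx Ly /(taut_mp Lx); apply: normal_mp. Qed.

Lemma imp_trans x y z : L (Imp x y) -> L (Imp y z) -> L (Imp x z).
Proof. by move=> h1 h2; apply: (taut_mp2 h1 h2); taut. Qed.

Lemma imp_refl x : L (Imp x x).
Proof. by apply: (normal_taut nL); taut. Qed.

Lemma or_elim x y z : L (Imp x z) -> L (Imp y z) -> L (Imp (Or x y) z).
Proof. by move=> h1 h2; apply: (taut_mp2 h1 h2); taut. Qed.

Lemma imp_orl x y z : L (Imp x y) -> L (Imp x (Or y z)).
Proof. by move=> h; apply: (taut_mp h); taut. Qed.

Lemma imp_orr x y z : L (Imp x z) -> L (Imp x (Or y z)).
Proof. by move=> h; apply: (taut_mp h); taut. Qed.

Lemma bot_imp x : L (Imp Bot x).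
Proof. by apply: (normal_taut nL); taut. Qed.

Section BigOr.
Variable I : finType.
Implicit Types F : I -> form A.

Lemma bigor_elim F x : (forall i, L (Imp (F i) x)) ->
  L (Imp (\big[@Or A/Bot]_i F i) x).
Proof.
move=> h; apply: (big_ind (fun y => L (Imp y x))) => //; first exact: bot_imp.
by move=> y z; apply: or_elim.
Qed.

Lemma bigor_intro F i x : L (Imp x (F i)) -> L (Imp x (\big[@Or A/Bot]_i F i)).
Proof.
move=> h; apply: imp_trans h _.
suff: forall s : seq I, i \in s -> L (Imp (F i) (\big[@Or A/Bot]_(i <- s) F i)).
  by apply; apply: mem_index_enum.
elim=> // j s IH; rewrite in_cons big_cons => /orP[/eqP <-|/IH]; last exact: imp_orr.
exact/imp_orl/imp_refl.
Qed.

End BigOr.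

(** Normality of an arbitrary operator, so that compounds such as [DiaLe m] can be handled like
    primitive modalities. *)
Record normal_op (D : form A -> form A) : Prop := NormalOp {
  op_mono : forall x y, L (Imp x y) -> L (Imp (D x) (D y));
  op_bot : L (Neg (D Bot));
  op_or : forall x y, L (Imp (D (Or x y)) (Or (D x) (D y)))
}.

Lemma normal_op_Dia a : normal_op (Dia a).
Proof.
split=> [x y||x y]; [exact: normal_mono|exact: normal_bot|].
exact: (normal_subst nL (fun n => if n is 0 then x else y) (normal_or nL a)).
Qed.

Lemma normal_op_id : normal_op id.
Proof. by split=> // *; apply: imp_refl. Qed.

Lemma normal_op_comp D E : normal_op D -> normal_op E -> normal_op (D \o E).
Proof.
move=> nD nE; split=> [x y||x y] /=.
- by move=> /(op_mono nE); apply: op_mono.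
- exact: imp_trans (op_mono nD (op_bot nE)) (op_bot nD).
- exact: imp_trans (op_mono nD (op_or nE x y)) (op_or nD _ _).
Qed.

Lemma normal_op_iter D n : normal_op D -> normal_op (iter n D).
Proof.
by move=> nD; elim: n => [|n IH]; [exact: normal_op_id|exact: normal_op_comp nD IH].
Qed.

Lemma normal_op_bigor (I : finType) (D : I -> form A -> form A) :
  (forall i, normal_op (D i)) ->
  normal_op (fun x => \big[@Or A/Bot]_i D i x).
Proof.
move=> nD; split=> [x y h||x y].
- by apply: bigor_elim => i; apply: (@bigor_intro _ _ i); apply: op_mono.
- by apply: bigor_elim => i; apply: op_bot.
- apply: bigor_elim => i; apply: imp_trans (op_or (nD i) x y) _; apply: or_elim.
  + by apply/imp_orl/(@bigor_intro _ _ i)/imp_refl.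
  + by apply/imp_orr/(@bigor_intro _ _ i)/imp_refl.
Qed.

Lemma op_bigor_elim D (I : finType) (F : I -> form A) x : normal_op D ->
  (forall i, L (Imp (D (F i)) x)) -> L (Imp (D (\big[@Or A/Bot]_i F i)) x).
Proof.
move=> nD h; apply: (big_ind (fun y => L (Imp (D y) x))) => //.
  exact: imp_trans (op_bot nD) (bot_imp x).
by move=> y z hy hz; apply: imp_trans (op_or nD y z) (or_elim hy hz).
Qed.

End Derivations.

(** * Alternations along an S4 operator *)

Section Alternation.
Variables (A : finType) (L : set (form A)) (D : form A -> form A).
Hypothesis nL : normal_logic L.
Hypothesis nD : normal_op L D.
Implicit Types p q u x : form A.

Fixpoint alternation j p : form A :=
  if j is j'.+1 then And p (D (alternation j' (Neg p))) else p.

Lemma alternation_le j n p :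
  L (Imp (alternation (n + j) p) (alternation j p)).
Proof.
elim: j p => [|j IH] p; last first.
  have h := op_mono nD (IH (Neg p)).
  by rewrite addnS /=; apply: (taut_mp nL h); taut.
by rewrite addn0; apply: (normal_taut nL); case: n => [|n]; taut.
Qed.

Hypothesis D_refl : forall x, L (Imp x (D x)).
Hypothesis D_trans : forall x, L (Imp (D (D x)) (D x)).

(** A successor where [D p] holds would give [D (D p)], hence [D p] by transitivity; so every
    successor inherits [Neg (D p)]. *)
Lemma notD_and p x :
  L (Imp (And (Neg (D p)) (D x)) (D (And (Neg (D p)) x))).
Proof.
have h : L (Imp (D x) (Or (D (D p)) (D (And (Neg (D p)) x)))).
  apply: (imp_trans nL _ (op_or nD _ _)).
  by apply: (op_mono nD); apply: (normal_taut nL); taut.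
by apply: (taut_mp2 nL h (D_trans p)); taut.
Qed.

(* [Neg (D p)] is closed under [D]-successors, so inside it alternations of [q]
   and [q'] coincide as soon as [q] and [q'] do. *)
Lemma alternation_local p j q q' :
  L (Imp (Neg (D p)) (Iff q q')) ->
  L (Imp (And (Neg (D p)) (alternation j q)) (alternation j q')).
Proof.
elim: j q q' => [|j IH] q q' h /=; first by apply: (taut_mp nL h); taut.
have /IH/(op_mono nD) h1 : L (Imp (Neg (D p)) (Iff (Neg q) (Neg q'))).
  by apply: (taut_mp nL h); taut.
have h2 := imp_trans nL (notD_and p _) h1.
by apply: (taut_mp2 nL h h2); taut.
Qed.

(* For a chain refuting [Bform D h], the rank of a point is the least [i <= h]
   such that none of [Var i.+1], ..., [Var h] is [D]-reachable from it;
   [rank_parity h] says that [h] minus the rank is even. *)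
Fixpoint rank_parity h : form A :=
  if h is h'.+1 then Or (D (Var h)) (Neg (rank_parity h')) else Neg Bot.

(** A point refuting [Bform D h.+1] satisfies [D v] by reflexivity, so its parity formula is true.
    It has a successor that refutes [Bform D h] and does not see [v]; there the parity formula for
    [h.+1] is the negation of that for [h], and induction supplies the other [h] alternations. *)
Lemma Bform_alternation h :
  L (Imp (Neg (Bform D h)) (alternation h (rank_parity h))).
Proof.
elim: h => [|h IH]; first by apply: (normal_taut nL); taut.
set v : form A := Var h.+1.
have h1 : L (Imp (And (Neg (D v)) (alternation h (rank_parity h)))
                 (alternation h (Neg (rank_parity h.+1)))).
  by apply: alternation_local; apply: (normal_taut nL); rewrite -/v; taut.
have h2 : L (Imp (Neg (Or (D v) (Bform D h)))
                 (alternation h (Neg (rank_parity h.+1)))).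
  by apply: (taut_mp2 nL IH h1); taut.
by apply: (taut_mp2 nL (op_mono nD h2) (D_refl v)); taut.
Qed.

(** After the first change [Neg x] holds, which excludes [D (Var h.+1)]. From there on [Neg x]
    agrees with [rank_parity h], so the remaining alternations contradict the induction
    hypothesis. *)
Lemma alternation_bound h : L (Neg (alternation h.+1 (rank_parity h))).
Proof.
elim: h => [|h IH].
  have /(op_mono nD) h1 : L (Imp (Neg (Neg Bot)) Bot).
    by apply: (normal_taut nL); taut.
  by apply: (taut_mp2 nL h1 (op_bot nD)); taut.
set x := rank_parity h.+1.
have h1 : L (Imp (And (Neg (D (Var h.+1))) (alternation h.+1 (Neg x)))
                 (alternation h.+1 (rank_parity h))).
  by apply: alternation_local; apply: (normal_taut nL); rewrite /x; taut.
have /(op_mono nD) h2 : L (Imp (alternation h.+1 (Neg x)) Bot).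
  apply: (taut_mp2 nL h1 IH); rewrite /x; taut.
by apply: (taut_mp2 nL h2 (op_bot nD)); rewrite /=; taut.
Qed.

Hypothesis D_subst : forall s x, subst s (D x) = D (subst s x).

Lemma subst_alternation s j p :
  subst s (alternation j p) = alternation j (subst s p).
Proof. by elim: j p => //= j IH p; rewrite D_subst IH. Qed.

Lemma alternation_collapse_Bform m n : m < n ->
  L (Imp (alternation m (Var 0)) (alternation n (Var 0))) -> L (Bform D m).
Proof.
move=> ltmn h.
have h1 : L (Imp (alternation m (Var 0)) (alternation m.+1 (Var 0))).
  by apply: (imp_trans nL h); rewrite -(subnK ltmn); apply: alternation_le.
(* For the parity formula, [m] alternations now force [m.+1], which the bound forbids; hence
   [Bform D m] cannot be refuted. *)
have := normal_subst nL (fun=> rank_parity m) h1.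
rewrite /= D_subst !subst_alternation => h2.
have h3 := imp_trans nL (Bform_alternation m) h2.
by apply: (taut_mp2 nL h3 (alternation_bound m)); taut.
Qed.

End Alternation.

(** * Finite height from 1-finiteness *)

(** Pigeonhole: otherwise [n] maps injectively to the class of [g n], embedding the naturals into a
    finite set. *)
Lemma k_finite_collapse (A : Type) (L : set (form A)) k (g : nat -> form A) :
    normal_logic L -> k_finite k L -> (forall n, vars_below k (g n)) ->
  exists m n, m < n /\ L (Iff (g m) (g n)).
Proof.
move=> nL fL gk; apply: contrapT => noeq.
have neq m n : m < n -> eq_class L k (g m) <> eq_class L k (g n).
  move=> ltmn eqmn; apply: noeq; exists m, n; split=> //.
  have : eq_class L k (g n) (g n).
    by split=> //; apply: (normal_taut nL); taut.
  by rewrite -eqmn => -[].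
apply: infinite_nat.
have -> : [set: nat] = (fun n => eq_class L k (g n)) @^-1`
    [set eq_class L k phi | phi in [set phi | vars_below k phi]].
  by apply/seteqP; split=> // n _ /=; exists (g n) => //=.
apply: finite_preimage fL => m n _ _ /= eqmn.
by case: (ltngtP m n) => // /neq; rewrite eqmn.
Qed.

Section FiniteHeight.
Variable A : finType.
Implicit Types (x : form A) (L : set (form A)).

Lemma vars_below_bigor k (I : finType) (F : I -> form A) :
  (forall i, vars_below k (F i)) -> vars_below k (\big[@Or A/Bot]_i F i).
Proof. by move=> h; apply: (big_ind (vars_below k)) => // x y /= -> ->. Qed.

Lemma vars_below_DiaLe k m x : vars_below k x -> vars_below k (DiaLe m x).
Proof.
move=> h; apply: vars_below_bigor => i; elim: (nat_of_ord i) => //= n IH.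
exact: vars_below_bigor.
Qed.

Lemma vars_below_alternation k m j x :
  vars_below k x -> vars_below k (alternation (DiaLe m) j x).
Proof.
elim: j x => //= j IH x h; rewrite h /= !andbT.
by apply/vars_below_DiaLe/IH; rewrite /= h.
Qed.

Lemma subst_DiaAll s x : subst s (DiaAll x) = DiaAll (subst s x).
Proof. exact: (big_morph (subst s) (op1 := @Or A) (id1 := Bot)). Qed.

Lemma subst_DiaLe s m x : subst s (DiaLe m x) = DiaLe m (subst s x).
Proof.
rewrite /DiaLe (big_morph (subst s) (op1 := @Or A) (id1 := Bot)) //.
apply: eq_bigr => i _; elim: (nat_of_ord i) => //= n <-; exact: subst_DiaAll.
Qed.

Variable L : set (form A).
Hypothesis nL : normal_logic L.

Lemma normal_op_DiaAll : normal_op L (@DiaAll A).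
Proof. by apply: normal_op_bigor => // a; apply: normal_op_Dia. Qed.

Lemma normal_op_DiaLe m : normal_op L (@DiaLe A m).
Proof.
apply: normal_op_bigor => // i; apply: normal_op_iter => //.
exact: normal_op_DiaAll.
Qed.

Lemma iter_DiaLe m i x : i <= m -> L (Imp (iter i (@DiaAll A) x) (DiaLe m x)).
Proof.
move=> leim; pose j : 'I_m.+1 := Ordinal (leim : i < m.+1).
exact: (@bigor_intro _ _ nL _ (fun i : 'I_m.+1 => iter i _ x) j _ (imp_refl nL _)).
Qed.

Section Pretransitive.
Variable m : nat.
Hypothesis tra_m :
  L (Imp (iter m.+1 (@DiaAll A) (Var 0)) (DiaLe m (Var 0))).

Lemma DiaAll_DiaLe x : L (Imp (DiaAll (DiaLe m x)) (DiaLe m x)).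
Proof.
apply: (op_bigor_elim nL normal_op_DiaAll) => i; rewrite -iterS.
(* Only the top disjunct [i = m] leaves the range of [DiaLe m]; it is brought back by [tra_m]. *)
have := ltn_ord i; rewrite ltnS leq_eqVlt => /predU1P[->|]; last exact: iter_DiaLe.
have := normal_subst nL (fun=> x) tra_m; rewrite /= subst_DiaAll subst_DiaLe.
have -> // : subst (fun=> x) (iter m (@DiaAll A) (Var 0)) = iter m (@DiaAll A) x.
by elim: (m) => //= n <-; rewrite subst_DiaAll.
Qed.

Lemma DiaLe_trans x : L (Imp (DiaLe m (DiaLe m x)) (DiaLe m x)).
Proof.
apply: bigor_elim => // i; elim: (nat_of_ord i) => [|n IH]; first exact: imp_refl.
exact: (imp_trans nL (op_mono normal_op_DiaAll IH) (DiaAll_DiaLe x)).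
Qed.

End Pretransitive.

Lemma least_isSome (P : nat -> Prop) n : P n -> isSome (least P).
Proof.
rewrite /least => Pn; case: pselect => // -[].
by exists n; apply/asboolP.
Qed.

Lemma least_Some (P : nat -> Prop) n : least P = Some n -> P n.
Proof.
by rewrite /least; case: pselect => // e [<-]; case: ex_minnP => k /asboolP.
Qed.

Lemma one_finite_tra : k_finite 1 L -> isSome (tra L).
Proof.
move=> fL; have [|m [n [ltmn h]]] :=
  @k_finite_collapse _ L 1 (fun i => DiaLe i (Var 0)) nL fL.
  by move=> n; apply: vars_below_DiaLe.
(* Since [m < n], the [m.+1]-fold iterate is a disjunct of [DiaLe n], which is equivalent to
   [DiaLe m]. *)
apply: (@least_isSome _ m); apply: (imp_trans nL (iter_DiaLe (Var 0) ltmn)).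
by apply: (taut_mp nL h); taut.
Qed.

Lemma one_finite_height : k_finite 1 L -> isSome (height L).
Proof.
move=> fL; rewrite /height; case E: (tra L) (one_finite_tra fL) => [m|//] _.
have tra_m := least_Some E.
have [|i [j [ltij h]]] :=
  @k_finite_collapse _ L 1 (fun i => alternation (DiaLe m) i (Var 0)) nL fL.
  by move=> n; apply: vars_below_alternation.
apply: (@least_isSome _ i).
apply: (alternation_collapse_Bform nL (normal_op_DiaLe m) _ _ _ ltij).
(* Reflexivity comes from the zeroth disjunct of [DiaLe m]. *)
- by move=> x; apply: (@iter_DiaLe m 0).
- exact: DiaLe_trans.
- by move=> s x; apply: subst_DiaLe.
- by apply: (taut_mp nL h); taut.
Qed.

End FiniteHeight.

(** * Restriction to a smaller alphabet *)

Section Restriction.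
Variables (Al : finType) (L : set (form Al)) (C : {set Al}).
Implicit Type phi : form {a : Al | a \in C}.

Lemma eval_map_form v phi :
  eval v (map_form val phi) = eval (fun psi => v (map_form val psi)) phi.
Proof. by elim: phi => //= phi1 -> phi2 ->. Qed.

Lemma subst_map_form s phi :
  map_form val (subst s phi) = subst (map_form val \o s) (map_form val phi).
Proof. by elim: phi => //= [phi1 -> phi2 ->|a phi ->]. Qed.

Lemma vars_below_map_form k phi :
  vars_below k (map_form val phi) = vars_below k phi.
Proof. by elim: phi => //= phi1 -> phi2 ->. Qed.

Lemma normal_restrict : normal_logic L -> normal_logic (restrict L C).
Proof.
move=> nL; split; rewrite /restrict /=.
- by move=> phi h; apply: (normal_taut nL) => v; rewrite eval_map_form.
- by move=> a; apply: normal_bot.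
- by move=> a; apply: normal_or.
- by move=> phi psi; apply: normal_mp.
- by move=> s phi; rewrite subst_map_form; apply: normal_subst.
- by move=> a phi psi; apply: normal_mono.
Qed.

(** Each class of the restriction is the preimage, under the inclusion of formulas, of a class of
    [L]. *)
Lemma k_finite_restrict k : k_finite k L -> k_finite k (restrict L C).
Proof.
move=> /(finite_image (fun X => @map_form {a | a \in C} Al val @^-1` X)) fL.
apply: sub_finite_set fL => _ [phi /= kphi <-].
exists (eq_class L k (map_form val phi)).
  by exists (map_form val phi); rewrite //= vars_below_map_form.
by apply/seteqP; split=> psi; rewrite /eq_class /= vars_below_map_form.
Qed.

End Restriction.

Theorem theorem3p14 (Al : finType) (L0 : set (form Al))
    (hL0 : normal_logic L0) :
  finite_height_criterion L0 -> one_finiteness_condition L0.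
Proof.
move=> crit L extL fL; apply/(crit L extL) => C.
apply: one_finite_height; first exact: normal_restrict extL.1.
exact: k_finite_restrict.
Qed.
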